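(* Let $n\ge1$ and let $f(X)=\sum_{i=0}^{n}a_{i}X^{i}$, $g(X)=\sum_{i=0}^{n}b_{i}X^{i}\in\mathbb{Z}[X]$ with $a_{0}a_{n}b_{0}b_{n}\neq 0$. Suppose that $|Res(f,g)|=pq$ with $p$ a prime number and $q$ a positive integer. Suppose also that for two positive real numbers $A,B$ with $B\geq A+q^{1/n}$ we have $|a_{n}|>\sum_{i=0}^{n-1}|a_{i}|A^{i-n}$ and $|b_{0}|>\sum_{i=1}^{n}|b_{i}|B^{i}$. Let $M$ and $N$ be integers with $Ma_n+Nb_n\neq 0$ and $Ma_0+Nb_0\neq 0$, satisfying one of the following two pairs of inequalities: $$|M|\leq\frac{B-A}{q^{1/n}}\quad\text{and}\quad |N|\leq|M|\cdot\frac{|a_{n}|-\sum_{i=0}^{n-1}|a_{i}|(B-q^{1/n}|M|)^{i-n}}{\sum_{i=0}^{n}|b_{i}|(B-q^{1/n}|M|)^{i-n}},$$ or $$|N|\leq\frac{B-A}{q^{1/n}}\quad\text{and}\quad |M|\leq|N|\cdot\frac{|b_{0}|-\sum_{i=1}^{n}|b_{i}|(A+q^{1/n}|N|)^{i}}{\sum_{i=0}^{n}|a_{i}|(A+q^{1/n}|N|)^{i}}.$$ Then the polynomial $Mf(X)+Ng(X)$ is irreducible over $\mathbb{Q}$.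
   Context: $Res(f,g)$ is the resultant of $f$ and $g$. *)

(* Defs.v *)
From HB Require Import structures.
From mathcomp Require Import all_boot all_order all_algebra.
From mathcomp Require Import reals exp.
Set Implicit Arguments.
Unset Strict Implicit.
Unset Printing Implicit Defensive.

(* Main.v *)
Require Import Defs.
From HB Require Import structures.
From mathcomp Require Import all_boot all_order all_algebra.
From mathcomp Require Import reals exp.
From mathcomp Require Import ring zify lra.
From mathcomp Require Import complex.
Set Implicit Arguments.
Unset Strict Implicit.
Unset Printing Implicit Defensive.
Import Order.TTheory GRing.Theory Num.Theory.
Local Open Scope ring_scope.

(** Write rho for the n-th root of q and h for M f + N g.  The coefficient
    conditions say that one coefficient dominates the others on a circle, and
    this locates complex roots: those of f satisfy |x| < A, those of g satisfy
    |x| > B, and, because dominance is stable under combinations with the given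
    bounds on M and N, those of h satisfy |y| <= B - rho |M| in the first case
    and |y| >= A + rho |N| in the second.  So the roots of h are at distance
    more than rho |M| from those of g, respectively more than rho |N| from those
    of f.

    The second case is the first with (f, M) and (g, N), and the inside and the
    outside of the circles, exchanged; so consider the first.  The resultant Res(g, h) is, up to sign and a power of the leading
    coefficient of g, the product of the values of h at the roots of g, where h
    and M f agree; hence Res(g, h) = M^n Res(g, f), of absolute value p m with
    m = q |M|^n = (rho |M|)^n.  If h = F G in Z[X] with nonconstant factors, then
    Res(g, F) Res(g, G) = Res(g, h), so p divides one of the two integers and the
    other one is at most m in absolute value.  But the resultant of g with a
    nonconstant factor of h is a product of nonzero integers (powers of leading
    coefficients) and of differences of roots, at least n of them, each larger
    than rho |M|, where (rho |M|)^n = m >= 1: it exceeds m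
    (resultant_gt_of_separated).  The contradiction is drawn in
    irreducible_of_separated, and Gauss's lemma passes from Z to Q.

    All this rests on the product formula for resultants, resultant_prodr, which
    is proved from the Sylvester determinant by splitting off one linear factor
    at a time (det_sylvester_step). *)

(** * Sylvester determinants and the product formula *)

Section SylvesterRows.
Variable R : nzRingType.
Implicit Types p q : {poly R}.

Definition coef_mx N (P : nat -> {poly R}) : 'M[R]_N := \matrix_(i, j) (P i)`_j.

(** Natural number indices let the Sylvester matrix be compared with smaller ones
    without casts between dimensions. *)
Definition sylvester_row m p q i := if (i < m)%N then 'X^i * p else 'X^(i - m) * q.

Lemma resultantE p q :
  resultant p q = \det (coef_mx ((size q).-1 + (size p).-1) (sylvester_row (size q).-1 p q)).
Proof.
congr (\det _); apply/matrixP=> i j; rewrite Sylvester_mxE !mxE /sylvester_row.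
by case: splitP => k ->; rewrite ?ltn_ord ?ltnNge ?leq_addr /= ?addKn coefXnM;
  case: leqP.
Qed.

End SylvesterRows.

Section CoefMatrix.
Variable K : fieldType.
Implicit Types p q r : {poly K}.

Lemma sum_delta n (d : nat -> K) k :
  \sum_(j < n) d j * (j == k :> nat)%:R = if (k < n)%N then d k else 0.
Proof.
case: ifPn => [ltkn|]; last first.
  rewrite -leqNgt => lenk; apply: big1 => j _.
  by rewrite ltn_eqF ?mulr0 // (leq_trans _ lenk).
rewrite (bigD1 (Ordinal ltkn)) //= eqxx mulr1 big1 ?addr0 // => j.
by rewrite -val_eqE /= => /negPf ->; rewrite mulr0.
Qed.

(** Expand the rows on the basis 1, X - a, X (X - a), X^2 (X - a), ... in place of
    the monomials: the change of basis is unitriangular, and as all rows but the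
    first vanish at a, the first coordinate contributes only through p(a). *)
Lemma det_coef_mx_factor N (a : K) p (P R : nat -> {poly K}) :
  (size p <= N.+1)%N -> (forall i, (i < N)%N -> (size (R i) <= N)%N) ->
  P 0%N = p -> (forall i, P i.+1 = R i * ('X - a%:P)) ->
  \det (coef_mx N.+1 P) = p.[a] * \det (coef_mx N R).
Proof.
move=> szp szR P0 PS.
have [r pE] : exists r, p - p.[a]%:P = r * ('X - a%:P).
  by apply/factor_theorem; rewrite /root hornerD hornerN hornerC subrr.
have szr : (size r <= N)%N.
  have [->|r0] := eqVneq r 0; first by rewrite size_poly0.
  have : (size (r * ('X - a%:P))%R <= N.+1)%N.
    rewrite -pE (leq_trans (size_polyD _ _)) // geq_max szp size_polyN.
    by rewrite (leq_trans (size_polyC_leq1 _)).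
  by rewrite size_Mmonic ?monicXsubC // size_XsubC addn2.
(* d j i is the coordinate of row i on the j-th vector of the new basis. *)
pose d j i : K := if j is j'.+1 then (if i is i'.+1 then (R i')`_j' else r`_j')
            else (if i is i'.+1 then 0 else p.[a]).
pose C : 'M[K]_N.+1 := \matrix_(i, j) d j i.
pose D : 'M[K]_(N.+1) := \matrix_(i, j) ((i == j :> nat)%:R - a * (i == j.+1 :> nat)%:R).
have dX (s : {poly K}) j : (s * ('X - a%:P))`_j = (if j is j'.+1 then s`_j' else 0) - a * s`_j.
  by rewrite mulrBr coefB coefMX coefMC mulrC; case: j.
have E : coef_mx N.+1 P = C *m D.
  apply/matrixP=> i j; rewrite !mxE.
  under eq_bigr => k _ do rewrite !mxE mulrBr mulrCA.
  rewrite sumrB -mulr_sumr.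
  rewrite !(sum_delta _ (d^~ i)) ltn_ord.
  have -> : (if (j.+1 < N.+1)%N then d j.+1 i else 0) = d j.+1 i.
    case: ltnP => // leNj; rewrite /d.
    case: i => [[|i] /= lti]; apply/esym/nth_default.
      exact: leq_trans szr leNj.
    exact: leq_trans (szR _ lti) leNj.
  case: i => [[|i] lti] /=.
    rewrite P0 -[p](subrK p.[a]%:P) pE coefD dX coefC.
    by case: (nat_of_ord j) => [|j'] /=; ring.
  by rewrite PS dX; case: (nat_of_ord j).
have -> : \det (coef_mx N.+1 P) = \det C.
  rewrite E det_mulmx [X in _ * X]det_trig; last first.
    apply/is_trig_mxP => i j ltij; rewrite mxE ltn_eqF // ltn_eqF ?mulr0 ?subr0 //.
    exact: ltnW.
  rewrite big1 ?mulr1 // => i _.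
  by rewrite mxE eqxx ltn_eqF // mulr0 subr0.
have -> : C = block_mx (p.[a])%:M (\row_j d j.+1 0%N) 0 (coef_mx N R) :> 'M_(1 + N).
  rewrite -[LHS](@submxK _ 1 N 1 N); congr block_mx; apply/matrixP=> i j.
  - by rewrite !mxE !ord1 eqxx.
  - by rewrite !mxE ord1.
  - by rewrite !mxE ord1.
  - by rewrite !mxE.
by rewrite (@det_ublock _ 1 N) det_scalar expr1.
Qed.

(** The rows p, X p, ..., X^m p become p, (X - a) p, ..., (X - a) X^(m-1) p by
    unitriangular row operations; then all rows but the first are multiples of
    X - a, with quotients the Sylvester rows of p and q. *)
Lemma det_sylvester_step m n a p q :
  (size p <= n.+1)%N -> (size q <= m.+1)%N ->
  \det (coef_mx (m.+1 + n) (sylvester_row m.+1 p (q * ('X - a%:P)))) =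
  p.[a] * \det (coef_mx (m + n) (sylvester_row m p q)).
Proof.
move=> szp szq; set P := sylvester_row _ _ _.
pose P' i := if i is i'.+1 then sylvester_row m p q i' * ('X - a%:P) else p.
pose E : 'M[K]_(m.+1 + n) := \matrix_(i, j)
  ((j == i :> nat)%:R - (if (0 < i <= m)%N then a else 0) * (j == i.-1 :> nat)%:R).
have <- : \det (coef_mx (m.+1 + n) P') = p.[a] * \det (coef_mx (m + n) (sylvester_row m p q)).
  apply: (@det_coef_mx_factor (m + n)) => //.
    by rewrite (leq_trans szp) // ltnS leq_addl.
  move=> i lti; rewrite /sylvester_row; case: ifPn => [ltim|].
    apply: leq_trans (size_polyMleq _ _) _; rewrite size_polyXn addSn /=.
    by apply: leq_trans (leq_add (leqnn _) szp) _; lia.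
  rewrite -leqNgt => lemi; apply: leq_trans (size_polyMleq _ _) _; rewrite size_polyXn addSn /=.
  by apply: leq_trans (leq_add (leqnn _) szq) _; lia.
suff <- : E *m coef_mx (m.+1 + n) P = coef_mx (m.+1 + n) P'.
  rewrite det_mulmx det_trig; last first.
    apply/is_trig_mxP => i j ltij; rewrite mxE !gtn_eqF ?mulr0 ?subr0 //.
    exact: leq_ltn_trans (leq_pred _) ltij.
  rewrite big1 ?mul1r // => i _; rewrite mxE eqxx.
  case: (nat_of_ord i) => [|k] /=; first by rewrite mul0r subr0.
  by rewrite gtn_eqF // mulr0 subr0.
apply/matrixP=> i j; rewrite !mxE.
under eq_bigr => k _ do rewrite !mxE mulrBl mulrC -mulrA [_%:R * _]mulrC.
rewrite sumrB -mulr_sumr !(sum_delta _ (fun l => (P l)`_j)) ltn_ord.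
rewrite (leq_ltn_trans (leq_pred _) (ltn_ord i)).
case: i => [[|i] lti] /=; first by rewrite mul0r subr0 /P /sylvester_row mul1r.
rewrite /P /sylvester_row !ltnS subSS.
case: (ltnP i m) => ltim; last by rewrite mul0r subr0 mulrA.
have -> : 'X^i * p * ('X - a%:P) = 'X^(i.+1) * p - a%:P * ('X^i * p).
  by rewrite exprS; ring.
by rewrite (ltnW ltim) coefB coefCM.
Qed.

Lemma det_sylvester_prod n c p (s : seq K) : (size p <= n.+1)%N ->
  \det (coef_mx (size s + n)
     (sylvester_row (size s) p (c *: \prod_(z <- s) ('X - z%:P)))) =
  c ^+ n * \prod_(z <- s) p.[z].
Proof.
move=> szp; elim: s => [|a s IHs].
  rewrite !big_nil mulr1 -det_scalar; congr (\det _).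
  apply/matrixP=> i j; rewrite !mxE /sylvester_row ltn0 subn0 alg_polyC coefMC coefXn.
  by rewrite eq_sym mulrC mulr_natr.
rewrite !big_cons mulrCA -IHs -[size (_ :: _)]/(size s).+1.
rewrite -det_sylvester_step // ?(leq_trans (size_scale_leq _ _)) ?size_prod_XsubC //.
by rewrite -!mul_polyC -mulrA [_ * ('X - a%:P)]mulrC.
Qed.

Lemma resultant_prodr c p (s : seq K) : c != 0 ->
  resultant p (c *: \prod_(z <- s) ('X - z%:P)) =
  c ^+ (size p).-1 * \prod_(z <- s) p.[z].
Proof.
move=> c0; rewrite resultantE size_scale // size_prod_XsubC /=.
by rewrite det_sylvester_prod // leqSpred.
Qed.

End CoefMatrix.

Lemma rmorph_resultant (aR : comNzRingType) (rR : comNzRingType) (f : {rmorphism aR -> rR}) p q :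
  injective f -> f (resultant p q) = resultant (map_poly f p) (map_poly f q).
Proof.
move=> injf; rewrite !resultantE !(size_map_inj_poly injf) ?rmorph0 // -det_map_mx.
congr (\det _); apply/matrixP=> i j; rewrite !mxE -coef_map /sylvester_row.
by case: ifP => _; rewrite rmorphM /= map_polyXn.
Qed.

Lemma prodrMl_seq (R : comNzRingType) (I : Type) (s : seq I) (u : R) (F : I -> R) :
  \prod_(x <- s) (u * F x) = u ^+ size s * \prod_(x <- s) F x.
Proof. by rewrite big_split /= big_const_seq count_predT -Monoid.iteropE. Qed.

Section ClosedField.
Variable C : closedFieldType.
Implicit Types p q : {poly C}.

(** The product formula in terms of the roots of the first argument, obtained by
    writing both sides as double products over the differences of roots.  The
    sign comes from reversing these differences. *)
Lemma resultant_prodl b q (s : seq C) : b != 0 -> q != 0 ->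
  resultant (b *: \prod_(x <- s) ('X - x%:P)) q =
  (-1) ^+ (size s * (size q).-1) * b ^+ (size q).-1 * \prod_(x <- s) q.[x].
Proof.
move=> b0; have [t ->] := closed_field_poly_normal q.
rewrite scaler_eq0 negb_or => /andP[]; move: (lead_coef q) => c c0 _.
rewrite resultant_prodr // !size_scale // !size_prod_XsubC /=.
under eq_bigr => y _ do rewrite hornerZ horner_prod.
under [X in _ = _ * X]eq_bigr => x _ do rewrite hornerZ horner_prod.
rewrite !prodrMl_seq exchange_big /=.
have E : \prod_(x <- s) \prod_(y <- t) ('X - x%:P).[y] =
  (-1) ^+ (size s * size t) * \prod_(x <- s) \prod_(y <- t) ('X - y%:P).[x].
  rewrite mulnC exprM -prodrMl_seq.
  apply: eq_bigr => x _; rewrite -prodrMl_seq.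
  by apply: eq_bigr => y _; rewrite !hornerXsubC mulN1r opprB.
by rewrite E; ring.
Qed.

Lemma resultantC p q : p != 0 -> q != 0 ->
  resultant p q = (-1) ^+ ((size p).-1 * (size q).-1) * resultant q p.
Proof.
move=> p0 q0; have [s pE] := closed_field_poly_normal p.
have b0 : lead_coef p != 0 by rewrite lead_coef_eq0.
have szs : (size p).-1 = size s by rewrite pE size_scale // size_prod_XsubC.
by rewrite [in LHS]pE resultant_prodl // szs [in RHS]pE resultant_prodr // mulrA.
Qed.

Lemma resultantMr p q r : p != 0 -> q != 0 -> r != 0 ->
  resultant p (q * r) = resultant p q * resultant p r.
Proof.
move=> p0 q0 r0; have [s ->] := closed_field_poly_normal p.
have b0 : lead_coef p != 0 by rewrite lead_coef_eq0.
rewrite !resultant_prodl ?mulf_neq0 // size_mul //.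
have -> : ((size q + size r).-1.-1 = (size q).-1 + (size r).-1)%N.
  by rewrite (polySpred q0) (polySpred r0) addnS.
rewrite mulnDr !exprD; under eq_bigr => x _ do rewrite hornerM.
by rewrite big_split /=; ring.
Qed.

(** At a root of q the combination takes the value u p. *)
Lemma resultant_comb u v p q : p != 0 -> q != 0 ->
  u *: p + v *: q != 0 -> size (u *: p + v *: q) = size p ->
  resultant q (u *: p + v *: q) = u ^+ (size q).-1 * resultant q p.
Proof.
move=> p0 q0 h0 szh; have [s qE] := closed_field_poly_normal q.
have b0 : lead_coef q != 0 by rewrite lead_coef_eq0.
have szs : (size q).-1 = size s by rewrite qE size_scale // size_prod_XsubC.
have hE x : x \in s -> (u *: p + v *: q).[x] = u * p.[x].
  move=> sx; rewrite hornerD !hornerZ qE hornerZ horner_prod.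
  by rewrite [X in _ * (_ * X)](big_rem x) //= hornerXsubC subrr mul0r !mulr0 addr0.
move: (u *: p + v *: q) h0 szh hE => h h0 szh hE.
rewrite [in LHS]qE resultant_prodl // szh szs [in RHS]qE resultant_prodl //.
have -> : \prod_(x <- s) h.[x] = u ^+ size s * \prod_(x <- s) p.[x].
  by rewrite -prodrMl_seq big_seq [RHS]big_seq; apply: eq_bigr.
by ring.
Qed.

End ClosedField.

(** * Irreducibility from separated roots *)

Lemma prod_gt_expr (R : numDomainType) (I : eqType) (s : seq I) (d : R) (F : I -> R) :
  1 <= d -> s != [::] -> (forall x, x \in s -> d < F x) ->
  d ^+ size s < \prod_(x <- s) F x.
Proof.
move=> d1; have d0 : 0 <= d by apply: le_trans d1.
elim: s => [//|x s IHs] _ dF; rewrite big_cons exprS.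
have [->|s0] := eqVneq s [::].
  by rewrite big_nil !mulr1 dF ?mem_head.
apply: ltr_pM; rewrite ?exprn_ge0 ?dF ?mem_head //.
by apply: IHs => // y ys; rewrite dF // inE ys orbT.
Qed.

Lemma norm_intr_ge1 (R : numDomainType) (z : int) : z != 0 -> 1 <= `|z%:~R : R|.
Proof. by move=> z0; rewrite -intr_norm -[1]/(1%:~R) ler_int; lia. Qed.

Section Separated.
Variable C : numClosedFieldType.
Local Notation toC := (map_poly (intr : int -> C)).

Lemma size_map_intr (q : {poly int}) : size (toC q) = size q.
Proof. by rewrite size_map_inj_poly //; apply: intr_inj. Qed.

Lemma map_intr_eq0 (q : {poly int}) : (toC q == 0) = (q == 0).
Proof. by rewrite -!size_poly_eq0 size_map_intr. Qed.

Lemma intr_resultant (q r : {poly int}) :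
  (resultant q r)%:~R = resultant (toC q) (toC r).
Proof. by apply: rmorph_resultant; apply: intr_inj. Qed.

(** Each root y of h makes |g(y)| exceed d^n, with n the degree of g: it is the
    product of the n distances to the roots of g, times a leading coefficient
    that is a nonzero integer.  One such root suffices, as d >= 1. *)
Lemma resultant_gt_of_separated (g h : {poly int}) (d : C) :
  (1 < size g)%N -> (1 < size h)%N -> 1 <= d ->
  (forall x y, root (toC g) x -> root (toC h) y -> d < `|x - y|) ->
  d ^+ (size g).-1 < `|resultant g h|%:~R.
Proof.
move=> szg szh d1 sep; have d0 : 0 <= d by apply: le_trans d1.
have leadC (p : {poly int}) : lead_coef (toC p) = (lead_coef p)%:~R.
  by rewrite lead_coef_map_inj //; apply: intr_inj.
have lead1 (p : {poly int}) : (1 < size p)%N -> 1 <= `|lead_coef (toC p)|.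
  move=> szp; rewrite leadC norm_intr_ge1 // lead_coef_eq0 -size_poly_gt0.
  exact: ltnW.
rewrite intr_norm intr_resultant.
have [s gE] := closed_field_poly_normal (toC g).
have [t hE] := closed_field_poly_normal (toC h).
have b1 := lead1 _ szg; have c1 := lead1 _ szh.
have b0 : lead_coef (toC g) != 0 by rewrite -normr_gt0 (lt_le_trans ltr01).
have c0 : lead_coef (toC h) != 0 by rewrite -normr_gt0 (lt_le_trans ltr01).
have szs : size g = (size s).+1 by rewrite -size_map_intr gE size_scale // size_prod_XsubC.
have szt : size h = (size t).+1 by rewrite -size_map_intr hE size_scale // size_prod_XsubC.
have root_prod (c : C) (r : seq C) x : x \in r ->
    root (c *: \prod_(z <- r) ('X - z%:P)) x.
  move=> xr; rewrite rootE hornerZ horner_prod (big_rem x) //=.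
  by rewrite hornerXsubC subrr mul0r mulr0.
have rootg x : x \in s -> root (toC g) x by move=> xs; rewrite gE root_prod.
have rooth y : y \in t -> root (toC h) y by move=> yt; rewrite hE root_prod.
have gy y : y \in t -> d ^+ size s < `|(toC g).[y]|.
  move=> yt; rewrite gE hornerZ horner_prod normrM normr_prod.
  apply: lt_le_trans (ler_peMl _ b1); last exact: prodr_ge0.
  apply: prod_gt_expr => // [|x xs]; first by rewrite -size_eq0 -lt0n -ltnS -szs.
  by rewrite hornerXsubC distrC sep ?rootg ?rooth.
rewrite hE resultant_prodr // size_map_intr szs /= normrM normrX normr_prod.
apply: lt_le_trans (ler_peMl _ (exprn_ege1 _ c1)); last exact: prodr_ge0.
have ds1 : 1 <= d ^+ size s by rewrite exprn_ege1.
apply: le_lt_trans (prod_gt_expr ds1 _ gy); last by rewrite -size_eq0 -lt0n -ltnS -szt.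
by apply: ler_eXnr; rewrite // -ltnS -szt.
Qed.

(** In a nontrivial integral factorization h = F G, neither Res(g, F) nor
    Res(g, G) is divisible by p, because the other one would then divide m
    whereas it exceeds d^n = m; yet their product is p m up to sign. *)
Lemma irreducible_of_separated (g h : {poly int}) (p m : nat) (d : C) :
  prime p -> (0 < m)%N -> (1 < size g)%N -> (1 < size h)%N ->
  `|resultant g h| = (p * m)%N%:Z -> 0 <= d -> d ^+ (size g).-1 = m%:R ->
  (forall x y, root (toC g) x -> root (toC h) y -> d < `|x - y|) ->
  irreducible_poly (map_poly (intr : int -> rat) h).
Proof.
move=> p_pr m0 szg szh resE d0 dE sep.
have neq0 (q : {poly int}) : (1 < size q)%N -> q != 0.
  by move=> szq; rewrite -size_poly_gt0 ltnW.
have d1 : 1 <= d.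
  have n0 : (0 < (size g).-1)%N by lia.
  by rewrite -(ler_pXn2r n0) ?nnegrE // expr1n dE ler1n.
have resM (F G : {poly int}) : (1 < size F)%N -> (1 < size G)%N ->
    resultant g (F * G) = resultant g F * resultant g G.
  move=> /neq0 F0 /neq0 G0; apply: (@intr_inj C).
  by rewrite rmorphM /= !intr_resultant rmorphM resultantMr // map_intr_eq0 // neq0.
have no_factor F G : h = F * G -> (1 < size F)%N -> (1 < size G)%N ->
    ~~ (p %| `|resultant g F|)%N.
  move=> hFG szF szG; apply/negP => /dvdnP[k kE].
  have : (`|resultant g F| * `|resultant g G| = p * m)%N.
    by rewrite -abszM -resM // -hFG; lia.
  rewrite kE mulnAC mulnC => /eqP; rewrite eqn_pmul2l ?prime_gt0 // => /eqP kG.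
  have : (`|resultant g G| <= m)%N by rewrite dvdn_leq // -kG dvdn_mull.
  rewrite leqNgt => /negP; apply; rewrite -(ltr_nat C) -dE.
  have := resultant_gt_of_separated szg szG d1.
  rewrite -abszE; apply => x y gx Gy; apply: sep => //.
  by rewrite hFG rmorphM rootM Gy orbT.
have no_split F G : h = F * G -> (1 < size F)%N -> (1 < size G)%N -> False.
  move=> hFG szF szG.
  have : (p %| `|resultant g F| * `|resultant g G|)%N.
    apply/dvdnP; exists m; rewrite -abszM -resM // -hFG; lia.
  rewrite Euclid_dvdM // (negPf (no_factor _ _ hFG szF szG)) /=.
  by apply/negP; apply: (no_factor G F); rewrite // mulrC.
split=> [|D szD]; first by rewrite size_rat_int_poly.
have h0 : map_poly (intr : int -> rat) h != 0.
  by rewrite -size_poly_gt0 size_rat_int_poly ltnW.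
move=> Dh; have D0 : D != 0 by apply: contraNneq h0 => D0; rewrite -dvd0p -D0.
(* Gauss's lemma: clear denominators in the rational divisor D and take the
   primitive part, so that the cofactor is integral. *)
have [F0 [a a0 DE]] := rat_poly_scale D.
have a0' : (a%:~R : rat)^-1 != 0 by rewrite invr_eq0 intr_eq0.
have : F0 %| h by rewrite -dvdp_rat_int -(dvdpZl _ _ a0') -DE.
case/dvdpP_int => G hE.
have szDF : size D = size (zprimitive F0).
  by rewrite DE size_scale // size_rat_int_poly size_zprimitive.
have F1 : (1 < size (zprimitive F0))%N.
  by rewrite -szDF ltn_neqAle eq_sym szD size_poly_gt0.
have G0 : G != 0 by apply: contraTneq szh => G0; rewrite hE G0 mulr0 size_poly0.
have [G1|G1] := ltnP 1 (size G); first by case: (no_split _ _ hE F1 G1).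
rewrite -dvdp_size_eqp // szDF size_rat_int_poly hE size_mul ?(neq0 _ F1) //.
have -> : size G = 1%N by apply/eqP; rewrite eqn_leq G1 size_poly_gt0.
by rewrite addn1.
Qed.

Lemma norm_resultantC (f g : {poly int}) : f != 0 -> g != 0 ->
  `|resultant f g| = `|resultant g f|.
Proof.
move=> f0 g0; apply: (@intr_inj C); rewrite !intr_norm !intr_resultant.
by rewrite resultantC ?map_intr_eq0 // normrM normrX normrN1 expr1n mul1r.
Qed.

Lemma resultant_comb_int (f g : {poly int}) (u v : int) :
  f != 0 -> g != 0 -> u *: f + v *: g != 0 -> size (u *: f + v *: g) = size f ->
  resultant g (u *: f + v *: g) = u ^+ (size g).-1 * resultant g f.
Proof.
move=> f0 g0 h0 szh.
apply: (@intr_inj C); rewrite rmorphM rmorphXn /= !intr_resultant.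
have hE : toC (u *: f + v *: g) = u%:~R *: toC f + v%:~R *: toC g.
  by rewrite rmorphD /= !map_polyZ.
by rewrite hE resultant_comb -?hE ?map_intr_eq0 ?size_map_intr.
Qed.

End Separated.

(** * Locating roots by a dominant coefficient *)

Section Dominance.
Variable R : realFieldType.
Implicit Types (n : nat) (c : nat -> R) (r t : R).

(** Going from r to t multiplies the top term by (t / r)^n and each other term
    by at most (t / r)^(n - 1); this gain makes the inequality strict even if it
    was an equality at r. *)
Lemma top_dominance_lt n c r t : (0 < n)%N -> (forall i, 0 <= c i) -> 0 < c n -> 0 < r < t ->
  \sum_(0 <= i < n) c i * r ^+ i <= c n * r ^+ n ->
  \sum_(0 <= i < n) c i * t ^+ i < c n * t ^+ n.
Proof.
case: n => [//|n] _ c0 cn0 /andP[r0 rt] dom.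
have t0 : 0 < t by apply: lt_trans rt.
set e := t / r; have e1 : 1 < e by rewrite ltr_pdivlMr ?mul1r.
have e0 : 0 < e by apply: lt_trans e1.
have tE i : t ^+ i = r ^+ i * e ^+ i.
  by rewrite -exprMn /e mulrCA divff ?mulr1 // gt_eqF.
have : \sum_(0 <= i < n.+1) c i * t ^+ i <=
       e ^+ n * \sum_(0 <= i < n.+1) c i * r ^+ i.
  rewrite mulr_sumr !big_mkord ler_sum // => i _.
  rewrite tE [leRHS]mulrC mulrA ler_wpM2l ?mulr_ge0 ?exprn_ge0 ?(ltW r0) //.
  by rewrite ler_weXn2l ?(ltW e1) // -ltnS.
move=> /le_lt_trans; apply; apply: le_lt_trans (ler_wpM2l _ dom) _.
  by rewrite exprn_ge0 // ltW.
rewrite tE mulrC -mulrA ltr_pM2l // ltr_pM2l ?exprn_gt0 //.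
by rewrite exprS ltr_pMl ?exprn_gt0.
Qed.

(** Going down from r to t multiplies every term but the constant one by at most
    t / r < 1. *)
Lemma bottom_dominance_lt n c r t : (forall i, 0 <= c i) -> 0 < c 0%N -> 0 <= t < r ->
  \sum_(1 <= i < n.+1) c i * r ^+ i <= c 0%N ->
  \sum_(1 <= i < n.+1) c i * t ^+ i < c 0%N.
Proof.
move=> c0 cn0 /andP[t0 tr] dom; have r0 : 0 < r by apply: le_lt_trans tr.
set e := t / r; have e1 : e < 1 by rewrite ltr_pdivrMr ?mul1r.
have e0 : 0 <= e by rewrite divr_ge0 // ltW.
have tE i : t ^+ i = r ^+ i * e ^+ i.
  by rewrite -exprMn /e mulrCA divff ?mulr1 // gt_eqF.
have : \sum_(1 <= i < n.+1) c i * t ^+ i <=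
       e * \sum_(1 <= i < n.+1) c i * r ^+ i.
  rewrite mulr_sumr !big_add1 !big_mkord ler_sum // => i _.
  rewrite tE [leRHS]mulrC mulrA ler_wpM2l ?mulr_ge0 ?exprn_ge0 ?(ltW r0) //.
  by rewrite exprS ler_piMr // exprn_ile1 // ltW.
move=> /le_lt_trans; apply; apply: le_lt_trans (ler_wpM2l e0 dom) _.
by rewrite gtr_pMl.
Qed.

End Dominance.

Section RootBounds.
Variable R : rcfType.
Local Notation C := R[i].
Implicit Types (n : nat) (c : nat -> int) (r : R) (x : C).
Local Open Scope complex_scope.

Local Notation toC := (map_poly (intr : int -> C)).

(** The norm on R[i] takes values in R[i]; its real part carries the bounds to the
    ordered field R. *)
Lemma norm_complexE x : `|x| = (complex.Re `|x|)%:C.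
Proof. by rewrite normc_def. Qed.

(** Isolate the leading term in the equation of the root and use the triangle
    inequality. *)
Lemma root_top_le n c x : root (toC (\sum_(0 <= i < n.+1) c i *: 'X^i)) x ->
  `|c n|%:~R * complex.Re `|x| ^+ n <=
  \sum_(0 <= i < n) `|c i|%:~R * complex.Re `|x| ^+ i.
Proof.
move=> /eqP; rewrite rmorph_sum horner_sum big_nat_recr //=.
under eq_bigr => i _ do rewrite map_polyZ map_polyXn hornerZ hornerXn.
rewrite map_polyZ map_polyXn hornerZ hornerXn => /(canRL (addKr _)).
rewrite addr0 => E; rewrite -lecR rmorph_sum rmorphM rmorphXn /= rmorph_int.
under [leRHS]eq_bigr => i _ do rewrite rmorphM rmorphXn /= rmorph_int.
rewrite -norm_complexE !intr_norm -normrX -normrM E normrN.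
apply: le_trans (ler_norm_sum _ _ _) _.
by rewrite le_eqVlt; apply/orP; left; apply/eqP/eq_bigr => i _; rewrite intr_norm -normrX -normrM.
Qed.

Lemma root_bottom_le n c x : root (toC (\sum_(0 <= i < n.+1) c i *: 'X^i)) x ->
  (`|c 0%N|%:~R : R) <= \sum_(1 <= i < n.+1) `|c i|%:~R * complex.Re `|x| ^+ i.
Proof.
move=> /eqP; rewrite rmorph_sum horner_sum big_nat_recl //= big_add1 /=.
under eq_bigr => i _ do rewrite map_polyZ map_polyXn hornerZ hornerXn.
rewrite map_polyZ map_polyXn hornerZ hornerXn mulr1 => /(canRL (addrK _)).
rewrite add0r => E; rewrite -lecR rmorph_sum /= rmorph_int.
under [leRHS]eq_bigr => i _ do rewrite rmorphM rmorphXn /= rmorph_int.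
rewrite -norm_complexE !intr_norm E normrN.
apply: le_trans (ler_norm_sum _ _ _) _.
by rewrite le_eqVlt; apply/orP; left; apply/eqP/eq_bigr => i _; rewrite intr_norm -normrX -normrM.
Qed.

Section Bounds.
Variables (n : nat) (c : nat -> int) (r : R) (x : C).
Hypothesis rx : root (toC (\sum_(0 <= i < n.+1) c i *: 'X^i)) x.

Lemma root_norm_le : (0 < n)%N -> 0 < r -> c n != 0 ->
  \sum_(0 <= i < n) `|c i|%:~R * r ^+ i <= `|c n|%:~R * r ^+ n ->
  complex.Re `|x| <= r.
Proof.
move=> n0 r0 cn0 dom; rewrite leNgt; apply/negP => rlt.
have := root_top_le rx; apply/negP; rewrite -ltNge.
apply: (top_dominance_lt (c := fun i => `|c i|%:~R) n0 _ _ _ dom).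
- by move=> i; rewrite ler0z.
- by rewrite ltr0z normr_gt0.
- by rewrite r0.
Qed.

Lemma root_norm_lt : (0 < n)%N -> 0 < r ->
  \sum_(0 <= i < n) `|c i|%:~R * r ^+ i < `|c n|%:~R * r ^+ n ->
  complex.Re `|x| < r.
Proof.
move=> n0 r0 dom; rewrite lt_neqAle root_norm_le ?(ltW dom) ?andbT //.
  apply: contraTneq (root_top_le rx) => ->.
  by rewrite -ltNge.
apply: contraTneq dom => ->; rewrite normr0 mul0r -leNgt.
by apply: sumr_ge0 => i _; rewrite mulr_ge0 ?ler0z ?exprn_ge0 // ltW.
Qed.

Lemma root_norm_ge : 0 < r -> c 0%N != 0 ->
  \sum_(1 <= i < n.+1) `|c i|%:~R * r ^+ i <= `|c 0%N|%:~R ->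
  r <= complex.Re `|x|.
Proof.
move=> r0 cn0 dom; rewrite leNgt; apply/negP => rlt.
have := root_bottom_le rx; apply/negP; rewrite -ltNge.
apply: (bottom_dominance_lt (c := fun i => `|c i|%:~R) _ _ _ dom).
- by move=> i; rewrite ler0z.
- by rewrite ltr0z normr_gt0.
- by rewrite rlt andbT -lecR -norm_complexE rmorph0.
Qed.

Lemma root_norm_gt : 0 < r ->
  \sum_(1 <= i < n.+1) `|c i|%:~R * r ^+ i < `|c 0%N|%:~R ->
  r < complex.Re `|x|.
Proof.
move=> r0 dom; rewrite lt_neqAle root_norm_ge ?(ltW dom) ?andbT //.
  by apply: contraTneq (root_bottom_le rx) => <-; rewrite -ltNge.
apply: contraTneq dom => ->; rewrite normr0 -leNgt.
by apply: sumr_ge0 => i _; rewrite mulr_ge0 ?ler0z ?exprn_ge0 // ltW.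
Qed.

End Bounds.

Lemma norm_sub_gt d x y :
  d < complex.Re `|x| - complex.Re `|y| -> d%:C < `|x - y|.
Proof.
move=> dlt; apply: lt_le_trans (lerB_dist _ _).
by rewrite [`|x|]norm_complexE [`|y|]norm_complexE -rmorphB ltcR.
Qed.

End RootBounds.

Lemma sum_scale_expz (F : numFieldType) m k n (c : nat -> int) (r : F) : r != 0 ->
  (\sum_(m <= i < k) `|c i|%:~R * r ^ (i%:Z - n%:Z)) * r ^+ n =
  \sum_(m <= i < k) `|c i|%:~R * r ^+ i.
Proof.
move=> r0; rewrite mulr_suml; apply: eq_bigr => i _.
by rewrite -mulrA -[r ^+ n]/(r ^ n%:Z) -expfzDr // subrK.
Qed.

(** * Linear combinations *)

Lemma size_sum_monomials n (c : nat -> int) : c n != 0 ->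
  size (\sum_(0 <= i < n.+1) c i *: 'X^i) = n.+1.
Proof. by move=> cn0; rewrite big_mkord -poly_def size_poly_eq. Qed.

Lemma sum_monomials_comb n (a b : nat -> int) (M N : int) :
  M *: (\sum_(0 <= i < n.+1) a i *: 'X^i) + N *: (\sum_(0 <= i < n.+1) b i *: 'X^i) =
  \sum_(0 <= i < n.+1) (M * a i + N * b i) *: 'X^i.
Proof.
rewrite !scaler_sumr -big_split /=; apply: eq_bigr => i _.
by rewrite !scalerA scalerDl.
Qed.

(** The separation criterion with d = rho |M| and m = q |M|^n, available because
    Res(g, M f + N g) = M^n Res(g, f).  Separation is asked of the moduli only,
    since the roots of g and those of M f + N g lie on the two sides of an
    annulus. *)
Lemma irreducible_comb (R : rcfType) (f g : {poly int}) (n p q : nat) (M N : int) (rho : R) :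
  (0 < n)%N -> size f = n.+1 -> size g = n.+1 -> size (M *: f + N *: g) = n.+1 ->
  prime p -> (0 < q)%N -> `|resultant g f| = (p * q)%N%:Z -> M != 0 ->
  0 < rho -> rho ^+ n = q%:R ->
  (forall x y : R[i], root (map_poly intr g) x -> root (map_poly intr (M *: f + N *: g)) y ->
     rho * `|M|%:~R < `|complex.Re `|x| - complex.Re `|y| |) ->
  irreducible_poly (map_poly (intr : int -> rat) (M *: f + N *: g)).
Proof.
move=> n0 szf szg szh p_pr q0 resE M0 rho0 rhoE sep.
have nz0 (r : {poly int}) : size r = n.+1 -> r != 0.
  by move=> szr; rewrite -size_poly_gt0 szr.
apply: (@irreducible_of_separated R[i] g _ p (q * `|M| ^ n)%N
  (real_complex R (rho * `|M|%:~R))) => //.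
- by rewrite muln_gt0 q0 expn_gt0 absz_gt0 M0.
- by rewrite szg.
- by rewrite szh.
- rewrite (resultant_comb_int R[i]) ?nz0 // ?szh ?szf // szg normrM normrX resE.
  by rewrite mulrC mulnA [RHS]PoszM -abszE -[X in _ = _ * X]natz natrX natz.
- by rewrite -[0]/(real_complex R 0) lecR mulr_ge0 ?(ltW rho0) // ler0z.
- rewrite szg -rmorphXn exprMn rhoE -abszE -natrX -natrM.
  by rewrite rmorph_nat.
- move=> x y gx hy; have := sep x y gx hy.
  rewrite real_ltr_normr ?num_real // opprB => /orP[]; first exact: norm_sub_gt.
  by move=> /norm_sub_gt; rewrite distrC.
Qed.

Lemma sum_norm_comb_le (R : numDomainType) m k (a b : nat -> int) (M N : int) (r : R) :
  0 <= r ->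
  \sum_(m <= i < k) `|M * a i + N * b i|%:~R * r ^+ i <=
  `|M|%:~R * (\sum_(m <= i < k) `|a i|%:~R * r ^+ i) +
  `|N|%:~R * (\sum_(m <= i < k) `|b i|%:~R * r ^+ i).
Proof.
move=> r0; rewrite !mulr_sumr -big_split /= ler_sum // => i _.
rewrite !mulrA -mulrDl ler_wpM2r ?exprn_ge0 // -!intrM -intrD ler_int.
by rewrite -!normrM ler_normD.
Qed.

(** The hypothesis is the bound on |N| cleared of its denominator: it moves the
    contribution of |N| |b n| to the side of |M| |a n|, where the reverse
    triangle inequality absorbs it. *)
Lemma top_dominance_comb (R : numDomainType) n (a b : nat -> int) (M N : int) (r : R) :
  0 <= r ->
  `|N|%:~R * (\sum_(0 <= i < n.+1) `|b i|%:~R * r ^+ i) <=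
  `|M|%:~R * (`|a n|%:~R * r ^+ n - \sum_(0 <= i < n) `|a i|%:~R * r ^+ i) ->
  \sum_(0 <= i < n) `|M * a i + N * b i|%:~R * r ^+ i <=
  `|M * a n + N * b n|%:~R * r ^+ n.
Proof.
move=> r0; rewrite big_nat_recr //= mulrDr mulrBr => dom.
have rhs_ge : `|M|%:~R * (`|a n|%:~R * r ^+ n) - `|N|%:~R * (`|b n|%:~R * r ^+ n) <=
    `|M * a n + N * b n|%:~R * r ^+ n.
  rewrite !mulrA -mulrBl ler_wpM2r ?exprn_ge0 // -!intrM -intrB ler_int.
  by rewrite -!normrM lerB_normD.
apply: le_trans (sum_norm_comb_le _ _ _ _ _ _ r0) (le_trans _ rhs_ge).
by rewrite lerBrDr -addrA addrC -lerBrDr.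
Qed.

(** The analogue for the bound on |M|, with constant coefficients in the dominant
    role. *)
Lemma bottom_dominance_comb (R : numDomainType) n (a b : nat -> int) (M N : int) (r : R) :
  0 <= r ->
  `|M|%:~R * (\sum_(0 <= i < n.+1) `|a i|%:~R * r ^+ i) <=
  `|N|%:~R * (`|b 0%N|%:~R - \sum_(1 <= i < n.+1) `|b i|%:~R * r ^+ i) ->
  \sum_(1 <= i < n.+1) `|M * a i + N * b i|%:~R * r ^+ i <=
  `|M * a 0%N + N * b 0%N|%:~R.
Proof.
move=> r0; rewrite big_ltn //= mulr1 mulrDr mulrBr => dom.
have rhs_ge : `|N|%:~R * `|b 0%N|%:~R - `|M|%:~R * `|a 0%N|%:~R <=
    `|M * a 0%N + N * b 0%N|%:~R :> R.
  by rewrite -!intrM -intrB ler_int [M * _ + _]addrC -!normrM lerB_normD.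
apply: le_trans (sum_norm_comb_le _ _ _ _ _ _ r0) (le_trans _ rhs_ge).
by rewrite lerBrDr addrAC -lerBrDr [X in X <= _]addrC.
Qed.

Lemma sum_norm_gt0 (R : numDomainType) n (c : nat -> int) (r : R) :
  0 < r -> c 0%N != 0 -> 0 < \sum_(0 <= i < n.+1) `|c i|%:~R * r ^+ i.
Proof.
move=> r0 c0; rewrite big_ltn // mulr1 ltr_wpDr ?ltr0z ?normr_gt0 //.
by apply: sumr_ge0 => i _; rewrite mulr_ge0 ?ler0z ?exprn_ge0 // ltW.
Qed.

Theorem theorem6p4 (R : realType) (n : nat) (a b : nat -> int) (f g : {poly int})
    (p q : nat) (A B : R) (M N : int) :
  (1 <= n)%N ->
  f = \sum_(0 <= i < n.+1) a i *: 'X^i ->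
  g = \sum_(0 <= i < n.+1) b i *: 'X^i ->
  a 0%N * a n * b 0%N * b n != 0 ->
  prime p ->
  (0 < q)%N ->
  `|resultant f g| = (p * q)%N%:Z ->
  0 < A ->
  0 < B ->
  A + q%:R `^ (n%:R^-1) <= B ->
  \sum_(0 <= i < n) `|a i|%:~R * A ^ (i%:Z - n%:Z) < `|a n|%:~R ->
  \sum_(1 <= i < n.+1) `|b i|%:~R * B ^+ i < `|b 0%N|%:~R ->
  M * a n + N * b n != 0 ->
  M * a 0%N + N * b 0%N != 0 ->
  (`|M|%:~R <= (B - A) / q%:R `^ (n%:R^-1) /\
   `|N|%:~R <= `|M|%:~R *
     ((`|a n|%:~R - \sum_(0 <= i < n)
          `|a i|%:~R * (B - q%:R `^ (n%:R^-1) * `|M|%:~R) ^ (i%:Z - n%:Z)) /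
      (\sum_(0 <= i < n.+1)
          `|b i|%:~R * (B - q%:R `^ (n%:R^-1) * `|M|%:~R) ^ (i%:Z - n%:Z))))
  \/
  (`|N|%:~R <= (B - A) / q%:R `^ (n%:R^-1) /\
   `|M|%:~R <= `|N|%:~R *
     ((`|b 0%N|%:~R - \sum_(1 <= i < n.+1)
          `|b i|%:~R * (A + q%:R `^ (n%:R^-1) * `|N|%:~R) ^+ i) /
      (\sum_(0 <= i < n.+1)
          `|a i|%:~R * (A + q%:R `^ (n%:R^-1) * `|N|%:~R) ^+ i))) ->
  irreducible_poly (map_poly (intr : int -> rat) (M *: f + N *: g)).
Proof.
move=> n0 fE gE /[!mulf_eq0] /[!negb_or] /andP[/andP[/andP[a0 an] b0] bn].
move=> p_pr q0 resE A0 B0 AB domf domg hn h0.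
set rho := _ `^ _ in AB *.
have rho0 : 0 < rho by rewrite powR_gt0 // ltr0n.
have rhoE : rho ^+ n = q%:R.
  by rewrite -powR_mulrn ?ltW // -powRrM mulVf ?powRr1 ?pnatr_eq0 -?lt0n ?ler0n.
have hE : M *: f + N *: g = \sum_(0 <= i < n.+1) (M * a i + N * b i) *: 'X^i.
  by rewrite fE gE sum_monomials_comb.
have szf : size f = n.+1 by rewrite fE size_sum_monomials.
have szg : size g = n.+1 by rewrite gE size_sum_monomials.
have szh : size (M *: f + N *: g) = n.+1.
  by rewrite hE (size_sum_monomials (c := fun i => M * a i + N * b i)).
have f0 : f != 0 by rewrite -size_poly_gt0 szf.
have g0 : g != 0 by rewrite -size_poly_gt0 szg.
case=> -[ML NL].
- set r := B - rho * `|M|%:~R in NL.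
  have Ar : A <= r by move: ML; rewrite ler_pdivlMr // /r mulrC; lra.
  have r0 : 0 < r by apply: lt_le_trans Ar.
  have rn0 : 0 < r ^+ n by rewrite exprn_gt0.
  rewrite mulrA ler_pdivlMr in NL; last first.
    by rewrite -(pmulr_lgt0 _ rn0) sum_scale_expz ?gt_eqF // sum_norm_gt0.
  have M0 : M != 0.
    apply: contraNneq hn => M0; move: NL; rewrite M0 normr0 mul0r.
    rewrite pmulr_lle0; last first.
      by rewrite -(pmulr_lgt0 _ rn0) sum_scale_expz ?gt_eqF // sum_norm_gt0.
    by rewrite lerz0 normr_le0 => /eqP ->; rewrite !mul0r addr0.
  have domh : \sum_(0 <= i < n) `|M * a i + N * b i|%:~R * r ^+ i <=
      `|M * a n + N * b n|%:~R * r ^+ n.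
    apply: top_dominance_comb; first exact: ltW.
    have := ler_wpM2r (ltW rn0) NL; rewrite -!mulrA sum_scale_expz ?gt_eqF //.
    by rewrite mulrBl sum_scale_expz ?gt_eqF.
  apply: (irreducible_comb n0 szf szg szh p_pr q0 _ M0 rho0 rhoE).
    by rewrite (norm_resultantC R[i]).
  move=> x y; rewrite hE gE => /root_norm_gt /(_ B0 domg) Bx.
  move=> /(root_norm_le (c := fun i => M * a i + N * b i)) /(_ n0 r0 hn domh) yr.
  by apply: lt_le_trans (ler_norm _); rewrite /r in yr; lra.
- set r := A + rho * `|N|%:~R in NL.
  have r0 : 0 < r by rewrite ltr_wpDr // mulr_ge0 ?(ltW rho0) // ler0z.
  rewrite mulrA ler_pdivlMr ?sum_norm_gt0 // in NL.
  have N0 : N != 0.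
    apply: contraNneq h0 => N0; move: NL; rewrite N0 normr0 mul0r.
    rewrite pmulr_lle0 ?sum_norm_gt0 //.
    by rewrite lerz0 normr_le0 => /eqP ->; rewrite !mul0r addr0.
  have domh := bottom_dominance_comb (ltW r0) NL.
  rewrite addrC in szh *.
  apply: (irreducible_comb n0 szg szf szh p_pr q0 _ N0 rho0 rhoE) => //.
  move=> x y; rewrite addrC hE fE => /root_norm_lt fx.
  move=> /(root_norm_ge (c := fun i => M * a i + N * b i)) /(_ r0 h0 domh) ry.
  have xA : complex.Re `|x| < A.
    apply: fx => //; rewrite -(sum_scale_expz _ _ n _ (lt0r_neq0 A0)).
    by rewrite ltr_pM2r // exprn_gt0.
  by rewrite distrC; apply: lt_le_trans (ler_norm _); rewrite /r in ry; lra.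
Qed.
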